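(* Let $G$ be a finite reflexive graph compatible with a distributive lattice $L$, and identify $L$ with the downset lattice $\mathcal{D}(J_L)$ via Birkhoff's isomorphism. Then there is a unique sub-digraph $A$ of $J_L$ satisfying the condition ''whenever $u'\le u\le v\le v'$ in $J_L$ and $(u',v')\in A$, then $(u,v)\in A$'' such that $G=G(J_L,A)$ (in particular $G\cong G(J_L,A)$).
   Context: A lattice $L$ on $V(G)$ is compatible with the reflexive graph $G$ if whenever $u\sim u'$ and $v\sim v'$ we have $u\wedge v\sim u'\wedge v'$ and $u\vee v\sim u'\vee v'$. For a finite distributive lattice $L$, $J_L$ is the poset of join-irreducible elements of $L$, and Birkhoff's theorem gives a lattice isomorphism $L\cong\mathcal{D}(J_L)$, where $\mathcal{D}(P)$ is the lattice of downsets of a poset $P$ ordered by inclusion. A poset $P$ is viewed as a reflexive digraph with an arc $(a,b)$ whenever $a\le b$ (including loops); a sub-digraph $A$ of $P$ has the same vertex set and a subset of the arcs. The graph $G(P,A)$ has vertex set $\mathcal{D}(P)$, with $D\sim D'$ iff $A$ contains every arc $(x,y)$ of $P$ for which $x,y$ both lie in $D\setminus D'$ or both lie in $D'\setminus D$. *)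

(* Defs.v *)
From HB Require Import structures.
From mathcomp Require Import all_boot all_order.

Set Implicit Arguments.
Unset Strict Implicit.
Unset Printing Implicit Defensive.

Import Order.TTheory Order.DefaultSetSubsetOrder.
Local Open Scope order_scope.

(* A finite reflexive graph on the vertex set T is a reflexive symmetric
   adjacency relation e : rel T. *)

Definition compatible (d : Order.disp_t) (L : latticeType d) (e : rel L) : Prop :=
  forall u u' v v' : L, e u u' -> e v v' ->
    e (u `&` v) (u' `&` v') /\ e (u `|` v) (u' `|` v').

Definition graph_isomorphism (T T' : Type) (e : rel T) (e' : rel T')
    (f : T -> T') : Prop :=
  bijective f /\ (forall u v : T, e u v = e' (f u) (f v)).

Definition is_downset (d : Order.disp_t) (P : finPOrderType d)
    (D : {set P}) : bool :=
  [forall x : P, forall y : P, (x <= y) && (y \in D) ==> (x \in D)].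

Record downset (d : Order.disp_t) (P : finPOrderType d) := Downset
  { downset_val :> {set P}; downsetP : is_downset downset_val }.

(* D(P) is a bounded sublattice of the lattice of subsets of P: it is ordered
   by inclusion, with intersection as meet and union as join. *)
Section DownsetLattice.
Context (d : Order.disp_t) (P : finPOrderType d).

Lemma is_downsetP (D : {set P}) :
  reflect (forall x y : P, x <= y -> y \in D -> x \in D) (is_downset D).
Proof.
apply: (iffP forallP) => [h x y lxy yD | h x].
  by move/forallP: (h x) => /(_ y) /implyP; apply; rewrite lxy.
by apply/forallP => y; apply/implyP => /andP[]; apply: h.
Qed.

Fact is_downsetI (D E : {set P}) :
  is_downset D -> is_downset E -> is_downset (D `&` E).
Proof.
move=> /is_downsetP hD /is_downsetP hE; apply/is_downsetP => x y lxy.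
by rewrite !inE => /andP[/(hD _ _ lxy) -> /(hE _ _ lxy) ->].
Qed.

Fact is_downsetU (D E : {set P}) :
  is_downset D -> is_downset E -> is_downset (D `|` E).
Proof.
move=> /is_downsetP hD /is_downsetP hE; apply/is_downsetP => x y lxy.
by rewrite !inE => /orP[/(hD _ _ lxy) -> | /(hE _ _ lxy) ->]; rewrite ?orbT.
Qed.

Fact is_downset0 : is_downset (\bot : {set P}).
Proof. by apply/is_downsetP => x y _; rewrite inE. Qed.

Fact is_downset1 : is_downset (\top : {set P}).
Proof. by apply/is_downsetP => x y _; rewrite !inE. Qed.

HB.instance Definition _ :=
  Order.isTBLatticeClosed.Build _ {set P} (@is_downset d P)
    is_downsetI is_downsetU is_downset0 is_downset1.

HB.instance Definition _ := [isSub for @downset_val d P].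
HB.instance Definition _ := [Finite of downset P by <:].
HB.instance Definition _ :=
  [SubChoice_isTBSubLattice of downset P by <:
     with Order.SetSubsetOrder.subset_display].

End DownsetLattice.

Definition join_irreducible (d : Order.disp_t) (L : finTBDistrLatticeType d)
    (j : L) : bool :=
  (j != \bot) &&
  [forall a : L, forall b : L, (j == a `|` b) ==> (j == a) || (j == b)].

Record join_irr (d : Order.disp_t) (L : finTBDistrLatticeType d) := JoinIrr
  { join_irr_val :> L; join_irrP : join_irreducible join_irr_val }.

HB.instance Definition _ (d : Order.disp_t) (L : finTBDistrLatticeType d) :=
  [isSub for @join_irr_val d L].
HB.instance Definition _ (d : Order.disp_t) (L : finTBDistrLatticeType d) :=
  [Finite of join_irr L by <:].
HB.instance Definition _ (d : Order.disp_t) (L : finTBDistrLatticeType d) :=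
  [SubChoice_isSubPOrder of join_irr L by <: with d].

Definition is_subdigraph (d : Order.disp_t) (P : finPOrderType d)
    (A : {set P * P}) : Prop :=
  forall x y : P, (x, y) \in A -> x <= y.

Definition interval_closed (d : Order.disp_t) (P : finPOrderType d)
    (A : {set P * P}) : Prop :=
  forall u' u v v' : P,
    u' <= u -> u <= v -> v <= v' -> (u', v') \in A -> (u, v) \in A.

Definition downset_graph (d : Order.disp_t) (P : finPOrderType d)
    (A : {set P * P}) : rel (downset P) :=
  fun D D' : downset P =>
    [forall x : P, forall y : P,
       (x <= y) &&
       ((x \in D :\: D') && (y \in D :\: D') ||
        (x \in D' :\: D) && (y \in D' :\: D))
       ==> ((x, y) \in A)].

(* Birkhoff's isomorphism L -> D(J_L): birkhoff is a lattice morphism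
   (see the instances below) and a bijection (birkhoff_bij). *)
Section Birkhoff.
Context (d : Order.disp_t) (L : finTBDistrLatticeType d).

Fact birkhoff_subproof (x : L) :
  is_downset [set j : join_irr L | join_irr_val j <= x].
Proof. by apply/is_downsetP => i j lij; rewrite !inE; apply: le_trans. Qed.

Definition birkhoff (x : L) : downset (join_irr L) :=
  Downset (birkhoff_subproof x).

Lemma mem_birkhoff (x : L) (j : join_irr L) :
  (j \in downset_val (birkhoff x)) = (join_irr_val j <= x).
Proof. by rewrite inE. Qed.

Lemma join_irr_prime (j : join_irr L) (x y : L) :
  (join_irr_val j <= x `|` y) = (join_irr_val j <= x) || (join_irr_val j <= y).
Proof.
apply/idP/orP => [jxy | [jx | jy]]; last 2 first.
- by apply: le_trans jx _; apply: leUl.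
- by apply: le_trans jy _; apply: leUr.
have /andP[_ /forallP/(_ (val j `&` x))/forallP/(_ (val j `&` y))] := join_irrP j.
rewrite -meetUr eq_sym -[_ == join_irr_val j]leEmeet jxy /=.
by rewrite ![val j == _]eq_sym -!leEmeet => /orP[]; [left | right].
Qed.

Lemma le_birkhoff : {mono birkhoff : x y / x <= y}.
Proof.
move=> x y; rewrite -[birkhoff x <= _]/(_ \subset _).
apply/subsetP/idP => [sub | lxy j]; last first.
  by rewrite !mem_birkhoff => /le_trans; apply.
apply/idPn => nxy.
pose bad z := (z <= x) && ~~ (z <= y).
have bx : bad x by rewrite /bad lexx.
have [z bz zmin] := @arg_minnP L x bad (fun z => #|[set t | t <= z]|) bx.
have /andP[zx nzy] := bz.
have zlt t : t < z -> t <= y.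
  move=> ltz; apply/idPn => nty.
  have /zmin : bad t by rewrite /bad nty (le_trans (ltW ltz)).
  rewrite leqNgt => /negP; apply; apply: proper_card; apply/properP; split.
    by apply/subsetP => s; rewrite !inE => /le_trans; apply; apply: ltW.
  by exists z; rewrite !inE ?lexx // lt_geF.
have jz : join_irreducible z.
  apply/andP; split; first by apply: contraNneq nzy => ->; apply: le0x.
  apply/forallP => a; apply/forallP => b; apply/implyP => /eqP zab.
  apply/idPn; rewrite negb_or => /andP[za zb].
  case/negP: nzy; rewrite zab leUx !zlt // lt_neqAle eq_sym ?za ?zb /= zab.
    exact: leUr.
  exact: leUl.
have := sub (JoinIrr jz); rewrite !mem_birkhoff /= zx => /(_ isT).
by rewrite (negPf nzy).
Qed.

Lemma birkhoff_bij : bijective birkhoff.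
Proof.
pose g (D : downset (join_irr L)) : L :=
  \join_(j in downset_val D) join_irr_val j.
have gK D : birkhoff (g D) = D.
  apply/val_inj/setP => j /=; rewrite mem_birkhoff.
  apply/idP/idP => [|jD]; last exact: joins_sup jD.
  rewrite /g; elim/big_rec: _ => [|i x iD IH].
    by rewrite lex0; have /andP[/negPf ->] := join_irrP j.
  rewrite join_irr_prime => /orP[ji | /IH //].
  have /is_downsetP h := downsetP D; exact: h _ _ ji iD.
exists g => // x; apply: (inc_inj le_birkhoff); exact: gK.
Qed.

Fact birkhoff_homo : {homo birkhoff : x y / x <= y}.
Proof. by move=> x y; rewrite le_birkhoff. Qed.

Fact birkhoff_meet : Order.meet_morphism birkhoff.
Proof.
by move=> x y; apply/val_inj/setP => j; rewrite /= !inE lexI.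
Qed.

Fact birkhoff_join : Order.join_morphism birkhoff.
Proof.
by move=> x y; apply/val_inj/setP => j; rewrite /= !inE join_irr_prime.
Qed.

HB.instance Definition _ :=
  Order.isOrderMorphism.Build _ L _ (downset (join_irr L)) birkhoff
    birkhoff_homo.
HB.instance Definition _ :=
  Order.isLatticeMorphism.Build _ L _ (downset (join_irr L)) birkhoff
    birkhoff_meet birkhoff_join.

End Birkhoff.

(* Main.v *)
Require Import Defs.
From mathcomp Require Import all_boot all_order.

(** An arc [(x, y)] of [J_L] is put in [A] when some neighbour [c] of [y] fails
    to be above [x]; taking meets with [y] shows that [A] is interval closed and
    that it contains every arc required by an edge of [G]. Conversely, suppose
    [c <= b] and all arcs inside [J(b) \ J(c)] lie in [A]. For [y] in
    [J(b) \ J(c)], the meet of the neighbours of [y] witnessing the arcs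
    [(x, y)] meets [y] inside [c], so [y] is adjacent to [y /\ c]; joining over
    all such [y] gives that [b] is adjacent to [c]. The arcs of any solution [A']
    are recovered from [G]: for [(x, y)] in [A'], the join of the
    join-irreducibles below [y] and not above [x] is adjacent to [y]. *)

Import Order.TTheory.

Section CompatibleGraph.
Local Open Scope order_scope.
Context (d : Order.disp_t) (L : finTBDistrLatticeType d) (G : rel L).
Hypotheses (Grefl : reflexive G) (Gsym : symmetric G) (Gcomp : compatible G).

Lemma le_join_irrP (x y : L) :
  reflect (forall j : join_irr L, join_irr_val j <= x -> join_irr_val j <= y)
    (x <= y).
Proof.
rewrite -(le_birkhoff x y) -[_ <= _]/(_ \subset _).
by apply: (iffP subsetP) => h j; move: (h j); rewrite !mem_birkhoff.
Qed.

Lemma compatible_meetl (a u v : L) : G u v -> G (a `&` u) (a `&` v).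
Proof. by move=> uv; have [] := Gcomp _ _ _ _ (Grefl a) uv. Qed.

Lemma compatible_joinl (a u v : L) : G u v -> G (a `|` u) (a `|` v).
Proof. by move=> uv; have [] := Gcomp _ _ _ _ (Grefl a) uv. Qed.

(** Joining the edges from [u] and [v] to their meet gives back the edge between [u] and [v] by
    absorption. This reduces adjacency to comparable pairs. *)
Lemma compatible_meetP (u v : L) :
  reflect (G u (u `&` v) /\ G v (u `&` v)) (G u v).
Proof.
apply: (iffP idP) => [uv | [um vm]].
  split; first by have := compatible_meetl u _ _ uv; rewrite meetxx.
  by have := compatible_meetl v _ _ uv; rewrite meetxx Gsym [v `&` u]meetC.
rewrite Gsym in vm; have [_] := Gcomp _ _ _ _ um vm.
by rewrite (join_l (leIl u v)) (join_r (leIr v u)).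
Qed.

(** By idempotence, taking the meet of edges that share the endpoint [y] keeps that endpoint. *)
Lemma compatible_bigmeet (I : finType) (P : pred I) (F : I -> L) (y : L) :
  (forall i, P i -> G y (F i)) -> G y (y `&` \meet_(i | P i) F i).
Proof.
move=> yF; elim/big_rec: _ => [|i m Pi ym]; first by rewrite meetx1.
have [] := Gcomp _ _ _ _ (yF i Pi) ym.
by rewrite meetxx meetCA.
Qed.

Lemma compatible_bigjoin (I : finType) (P : pred I) (F : I -> L) (c : L) :
  (forall i, P i -> G c (c `|` F i)) -> G c (c `|` \join_(i | P i) F i).
Proof.
move=> cF; elim/big_rec: _ => [|i m Pi cm]; first by rewrite joinx0.
have [_] := Gcomp _ _ _ _ (cF i Pi) cm.
by rewrite joinxx joinACA joinxx.
Qed.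

Definition arc_digraph : {set join_irr L * join_irr L} :=
  [set p | (p.1 <= p.2) &&
     [exists c : L, G (join_irr_val p.2) c && ~~ (join_irr_val p.1 <= c)]].

Lemma arc_digraphP (x y : join_irr L) :
  reflect
    (x <= y /\
     exists2 c : L, G (join_irr_val y) c & ~~ (join_irr_val x <= c))
    ((x, y) \in arc_digraph).
Proof.
rewrite inE /=; apply: (iffP andP) => [[xy /existsP[c /andP[yc xc]]]|].
  by split=> //; exists c.
by move=> [xy [c yc xc]]; split=> //; apply/existsP; exists c; rewrite yc.
Qed.

Lemma arc_digraph_interval_closed : interval_closed arc_digraph.
Proof.
move=> u' u v v' u'u uv vv' /arc_digraphP[_ [c v'c u'c]].
(* Meeting the edge from [v'] to [c] with [v <= v'] turns it into an edge at [v]. *)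
apply/arc_digraphP; split=> //; exists (join_irr_val v `&` c).
  have := compatible_meetl (join_irr_val v) _ _ v'c.
  by have /meet_idPl -> : join_irr_val v <= join_irr_val v' by [].
apply: contraNN u'c => uc.
apply: le_trans (_ : join_irr_val u <= c); first exact: u'u.
by apply: le_trans uc _; apply: leIr.
Qed.

Lemma adjacent_arc (u v : L) (x y : join_irr L) :
  G u v -> x <= y -> join_irr_val y <= u -> ~~ (join_irr_val x <= v) ->
  (x, y) \in arc_digraph.
Proof.
move=> uv xy yu xv; apply/arc_digraphP; split=> //.
exists (join_irr_val y `&` v).
  by have := compatible_meetl (join_irr_val y) _ _ uv; rewrite (meet_idPl yu).
by apply: contraNN xv => /le_trans; apply; apply: leIr.
Qed.

Lemma join_irr_adjacent_meet (c : L) (y : join_irr L) :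
  (forall x : join_irr L, x <= y -> ~~ (join_irr_val x <= c) ->
     (x, y) \in arc_digraph) ->
  G (join_irr_val y) (join_irr_val y `&` c).
Proof.
move=> arcs.
(* The default [y] is its own neighbour by reflexivity, so the meet below can range over all [x]. *)
pose nb (x : join_irr L) : L := odflt (join_irr_val y)
  [pick e | G (join_irr_val y) e && ~~ (join_irr_val x <= e)].
have ynb x : G (join_irr_val y) (nb x).
  by rewrite /nb; case: pickP => [e /andP[]|].
have nbx x : x <= y -> ~~ (join_irr_val x <= c) -> ~~ (join_irr_val x <= nb x).
  move=> xy xc; have /arc_digraphP[_ [e ye xe]] := arcs x xy xc.
  rewrite /nb; case: pickP => [f /andP[]//|/(_ e)].
  by rewrite ye xe.
pose m : L := join_irr_val y `&` \meet_x nb x.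
have ym : G (join_irr_val y) m by apply: compatible_bigmeet.
(* A join-irreducible below [m] but not below [c] would lie below its own witness [nb x]. *)
have mc : m <= join_irr_val y `&` c.
  rewrite lexI leIl /=; apply/le_join_irrP => x.
  rewrite lexI => /andP[xy xm]; apply/idPn => /(nbx x xy) /negP; apply.
  by apply: le_trans xm _; apply: meets_inf.
(* As [m <= y /\ c <= y], this join lifts [m] to [y /\ c] and fixes [y]. *)
have := compatible_joinl (join_irr_val y `&` c) _ _ ym.
by rewrite (join_l mc) (join_r (leIl _ _)).
Qed.

Lemma arcs_adjacent (c b : L) :
  c <= b ->
  (forall x y : join_irr L,
     x <= y -> join_irr_val y <= b -> ~~ (join_irr_val x <= c) ->
     (x, y) \in arc_digraph) ->
  G b c.
Proof.
move=> cb arcs.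
pose P (y : join_irr L) := (join_irr_val y <= b) && ~~ (join_irr_val y <= c).
have -> : b = c `|` \join_(y | P y) join_irr_val y.
  apply/le_anti; rewrite leUx cb /=; apply/andP; split; last first.
    by apply/joinsP => y /andP[].
  apply/le_join_irrP => j jb; have [jc|jc] := boolP (join_irr_val j <= c).
    by apply: le_trans jc _; apply: leUl.
  apply: le_trans (leUr _ _).
  by apply: (@joins_sup _ _ _ j P (fun y => join_irr_val y)); rewrite /P jb jc.
rewrite Gsym; apply: compatible_bigjoin => y /andP[yb yc].
have := @join_irr_adjacent_meet c y (fun x xy => arcs x y xy yb).
(* By absorption, the edge from [y] to [y /\ c] becomes one from [c \/ y] to [c]. *)
move=> /(compatible_joinl c); rewrite [c `|` (_ `&` _)]meetKUC.
by rewrite Gsym.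
Qed.

Lemma downset_graph_sym (e : Order.disp_t) (P : finPOrderType e)
    (A : {set P * P}) : symmetric (downset_graph A).
Proof.
by move=> D E; apply: eq_forallb => x; apply: eq_forallb => y; rewrite orbC.
Qed.

(** If [x <= y] and [x] is not below [v], neither is [y]; so an arc with [y] below [u] and [x] not
    below [u /\ v] has both ends in the difference of the downsets. *)
Lemma downset_graph_adjacent_meet (u v : L) :
  downset_graph arc_digraph (birkhoff u) (birkhoff v) -> G u (u `&` v).
Proof.
move=> /forallP arcs; apply: arcs_adjacent; first exact: leIl.
move=> x y xy yu xn; move: (arcs x) => /forallP/(_ y)/implyP; apply.
have xu : join_irr_val x <= u by apply: le_trans yu.
have xv : ~~ (join_irr_val x <= v) by apply: contraNN xn; rewrite lexI xu.
have yv : ~~ (join_irr_val y <= v) by apply: contraNN xv; apply: le_trans.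
by rewrite xy !in_setD !mem_birkhoff xu xv yu yv.
Qed.

Lemma arc_digraph_adjacent (u v : L) :
  G u v = downset_graph arc_digraph (birkhoff u) (birkhoff v).
Proof.
apply/idP/idP => uv; last first.
  apply/compatible_meetP; split; first exact: downset_graph_adjacent_meet.
  rewrite meetC; apply: downset_graph_adjacent_meet.
  by rewrite downset_graph_sym.
apply/forallP => x; apply/forallP => y; apply/implyP => /andP[xy].
rewrite !in_setD !mem_birkhoff => /orP[] /andP[/andP[xn _] /andP[_ yu]].
  exact: adjacent_arc _ _ _ _ uv xy yu xn.
by rewrite Gsym in uv; apply: adjacent_arc _ _ _ _ uv xy yu xn.
Qed.

Lemma arc_digraph_unique (A : {set join_irr L * join_irr L}) :
  is_subdigraph A -> interval_closed A ->
  (forall u v : L, G u v = downset_graph A (birkhoff u) (birkhoff v)) ->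
  arc_digraph = A.
Proof.
move=> Asub Aint GA; apply/setP => -[x y]; apply/arc_digraphP/idP.
  move=> [xy [c yc xc]]; rewrite GA in yc.
  move/forallP: yc => /(_ x) /forallP/(_ y) /implyP; apply.
  have yc : ~~ (join_irr_val y <= c) by apply: contraNN xc; apply: le_trans.
  rewrite xy !inE xc yc lexx /=.
  by have -> : join_irr_val x <= join_irr_val y by [].
move=> Axy; have xy := Asub _ _ Axy; split=> //.
(* [D] is chosen so that removing it from the downset of [y] leaves exactly the interval from [x] to
   [y], all of whose arcs are in [A] by interval closure. *)
pose D := [set j : join_irr L | (j <= y) && ~~ (x <= j)].
have Ddown : is_downset D.
  apply/is_downsetP => i j ij; rewrite !inE => /andP[jy xj].
  by rewrite (le_trans ij jy) (contraNN _ xj) // => /le_trans; apply.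
have [g _ gK] := birkhoff_bij L.
pose c := g (Downset Ddown).
have memc j : (join_irr_val j <= c) = (j <= y) && ~~ (x <= j).
  by rewrite -mem_birkhoff gK inE.
exists c; last by rewrite memc xy lexx.
rewrite GA; apply/forallP => u; apply/forallP => v; apply/implyP => /andP[uv].
rewrite !inE !memc => /orP[] /andP[/andP[un uy] /andP[vn vy]].
  apply: Aint Axy => //; move: un; have -> : u <= y by [].
  by rewrite negbK.
(* This case is void, since [c <= y]. *)
by case/andP: uy un => uy _ /negP[].
Qed.

End CompatibleGraph.

Theorem theorem4p3 (d : Order.disp_t) (L : finTBDistrLatticeType d) (G : rel L)
    (Grefl : reflexive G) (Gsym : symmetric G) (Gcomp : compatible G) :
  exists! A : {set join_irr L * join_irr L},
    [/\ is_subdigraph A,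
        interval_closed A &
        graph_isomorphism G (downset_graph A) (@birkhoff d L)].
Proof.
exists (arc_digraph d L G); split=> [|A [Asub Aint [_ GA]]].
  split.
  - by move=> x y /arc_digraphP[].
  - exact: arc_digraph_interval_closed.
  - split; first exact: birkhoff_bij.
    exact: arc_digraph_adjacent.
exact: arc_digraph_unique.
Qed.
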